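(* Let $\mathbb{K}$ be a field of characteristic zero and let $\alpha,\beta\in\mathbb{K}$. The representation $V_{\alpha,\beta}$ of the Witt algebra, when restricted to the subalgebra $\mathfrak{sl}_2=\mathrm{span}\{\xi_{-1},\xi_0,\xi_1\}$, contains a non-zero finite dimensional $\mathfrak{sl}_2$-submodule precisely when $\alpha$ is a non-positive half-integer and $\alpha+\beta$ is an integer. When these conditions hold, the (non-zero finite dimensional) submodule is unique, and it has dimension $-2\alpha+1$, meaning that it is isomorphic to the representation of $\mathfrak{sl}_2$ on homogeneous polynomials of degree $-2\alpha$ in two variables.
   Context: The Witt algebra is the Lie algebra $\mathrm{Vect}(\mathbb{G}_m)$ over $\mathbb{K}$ with basis $\xi_i=z^{i+1}\partial_z$, $i\in\mathbb{Z}$, and bracket $[\xi_i,\xi_j]=(j-i)\xi_{i+j}$ (it is isomorphic to $SH^1(\mathbb{C}^* )$). The elements $e=\xi_1$, $h=2\xi_0$, $f=-\xi_{-1}$ satisfy $[h,e]=2e$, $[h,f]=-2f$, $[e,f]=h$. $V_{\alpha,\beta}$ is the space of formal densities $P(z)z^\beta(dz/z)^\alpha$, $P\in\mathbb{K}[z,z^{-1}]$, with action by formal Lie derivative; equivalently, it is $\mathbb{K}[z,z^{-1}]$ with action $\xi_i\cdot z^j=(j+\alpha i+\beta)z^{i+j}$. Here ''half-integer'' means an element of $\tfrac12\mathbb{Z}$ (integers included), and ''non-positive'' refers to the usual order on $\tfrac12\mathbb{Z}\subset\mathbb{Q}\subset\mathbb{K}$. *)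

(* Defs.v *)
From HB Require Import structures.
From mathcomp Require Import all_boot all_order all_algebra.
From mathcomp Require Import finmap ring.
From mathcomp.multinomials Require mpoly monalg.

Set Implicit Arguments.
Unset Strict Implicit.
Unset Printing Implicit Defensive.

Import GRing.Theory.

Local Open Scope ring_scope.

(* The standard representation of sl_2 on polynomials in two variables: the
   traceless matrix A acts as the derivation extending the linear map
   'X_j |-> \sum_i A i j *: 'X_i. *)
Section BinaryForms.
Import mpoly.
Variable K : fieldType.
Implicit Types (A B : 'M[K]_2) (p q : {mpoly K[2]}).

Definition form_act A p : {mpoly K[2]} :=
  \sum_(i < 2) \sum_(j < 2) A i j *: ('X_i * p^`M(j)).

Lemma form_act_homog n A p :
  p \is n.-homog -> form_act A p \is n.-homog.
Proof.
move=> hp; apply: rpred_sum => i _; apply: rpred_sum => j _; apply: rpredZ.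
apply/dhomogP => m /msuppM_le /allpairsP[[m1 m2] /= [+ + ->]].
rewrite msuppX inE => /eqP -> m2P; rewrite mdegD mdeg1.
have : (m2 + U_(j))%MM \in msupp p.
  apply: contraLR m2P => /memN_msupp_eq0 p0.
  by rewrite -mcoeff_eq0 mcoeff_deriv p0 mul0rn.
by move/(dhomog_mf hp) => <- /=; rewrite mdegD mdeg1 addnC.
Qed.

Lemma form_act_bracket A B p :
  form_act (A *m B - B *m A) p =
    form_act A (form_act B p) - form_act B (form_act A p).
Proof.
have dX i j : 'X_i^`M(j) = (i == j)%:R :> {mpoly K[2]}.
  rewrite mderivX mnm1E; case: eqVneq => [->|_]; rewrite ?scale0r //.
  by rewrite scale1r -{1}[U_(j)%MM]add0m addmK mpolyX0.
have S2 (V : nmodType) (F : 'I_2 -> V) : \sum_i F i = F 0 + F 1.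
  by rewrite !big_ord_recl big_ord0 addr0; congr (_ + F _); apply: val_inj.
have faE C q : form_act C q =
    (C 0 0)%:MP * ('X_0 * q^`M(0)) + (C 0 1)%:MP * ('X_0 * q^`M(1))
    + ((C 1 0)%:MP * ('X_1 * q^`M(0)) + (C 1 1)%:MP * ('X_1 * q^`M(1))).
  by rewrite /form_act !S2 !mul_mpolyC.
have dA k C q : (form_act C q)^`M(k) =
    (C 0 0)%:MP * ((0 == k)%:R * q^`M(0) + 'X_0 * q^`M(0)^`M(k))
    + (C 0 1)%:MP * ((0 == k)%:R * q^`M(1) + 'X_0 * q^`M(1)^`M(k))
    + ((C 1 0)%:MP * ((1 == k)%:R * q^`M(0) + 'X_1 * q^`M(0)^`M(k))
       + (C 1 1)%:MP * ((1 == k)%:R * q^`M(1) + 'X_1 * q^`M(1)^`M(k))).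
  by rewrite faE !mderivD !mderiv_mulC !mderivM !dX.
rewrite faE [form_act A (form_act B p)]faE [form_act B (form_act A p)]faE !dA.
rewrite !mxE !S2 (mderiv_comm 1 0 p) !rmorphB !rmorphD !rmorphM /=.
move: p^`M(0) p^`M(1) p^`M(0)^`M(0) p^`M(0)^`M(1) p^`M(1)^`M(1).
move=> p0 p1 p00 p01 p11.
ring.
Qed.

Definition form_act_dhomog n A (p : dhomog 2 K n) : dhomog 2 K n :=
  DHomog (form_act_homog A (dhomog_is_dhomog p)).

End BinaryForms.

(* Both the Witt algebra and the space K[z, z^-1] underlying V_(alpha, beta)
   are free K-vector spaces with a basis indexed by the integers, represented
   by {malg K[int]}: the basis vector << i >> is xi_i in the former and z^i in
   the latter. *)

Section LinearExtension.
Import monalg.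
Variables (K : fieldType) (U : lmodType K).
Implicit Types (f : int -> U) (x y : {malg K[int]}).

(* The linear map sending << i >> to f i. *)
Definition linext f x : U := \sum_(i <- msupp x) x@_i *: f i.

Lemma linextEw f x (d : {fset int}) : fsubset (msupp x) d ->
  linext f x = \sum_(i <- d) x@_i *: f i.
Proof.
move=> sxd; rewrite /linext (big_fset_incl _ sxd) // => i _ Ni.
by rewrite mcoeff_outdom // scale0r.
Qed.

Lemma linext_is_linear f : linear (linext f).
Proof.
move=> a x y; pose d := fsetU (msupp x) (msupp y).
rewrite (@linextEw _ (a *: x + y) d); last first.
  by apply: (fsubset_trans (msuppD_le _ _)); rewrite fsetSU // msuppZ_le.
rewrite (@linextEw _ x d) ?fsubsetUl // (@linextEw _ y d) ?fsubsetUr //.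
rewrite scaler_sumr -big_split /=; apply: eq_bigr => i _.
by rewrite mcoeffD mcoeffZ scalerDl scalerA.
Qed.

HB.instance Definition _ f :=
  GRing.isLinear.Build K {malg K[int]} U _ (linext f) (linext_is_linear f).

Lemma linextU f i : linext f << i >> = f i.
Proof.
by rewrite (@linextEw _ _ [fset i]%fset) ?msuppU_le // big_seq_fset1
  mcoeffUU scale1r.
Qed.

Lemma eq_linext f g : f =1 g -> linext f =1 linext g.
Proof. by move=> fg x; apply: eq_bigr => i _; rewrite fg. Qed.

Lemma linextD f g x : linext (fun i => f i + g i) x = linext f x + linext g x.
Proof. by rewrite -big_split; apply: eq_bigr => i _; rewrite scalerDr. Qed.

Lemma linextZ a f x : linext (fun i => a *: f i) x = a *: linext f x.
Proof.
rewrite scaler_sumr; apply: eq_bigr => i _.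
by rewrite !scalerA mulrC.
Qed.

Lemma malg_linear_ext (g h : {linear {malg K[int]} -> U}) :
  (forall i, g << i >> = h << i >>) -> g =1 h.
Proof.
move=> gh x; rewrite [x]monalgE !raddf_sum; apply: eq_bigr => i _.
have -> : << x@_i *g i >> = x@_i *: << i >> :> {malg K[int]}.
  by apply/malgP => j; rewrite mcoeffZ !mcoeffU mulrnAr mulr1.
by rewrite /= !linearZ_LR gh.
Qed.

End LinearExtension.

Section Witt.
Import monalg.
Variable K : fieldType.
Implicit Types (A B : 'M[K]_2) (alpha beta : K) (x y z v : {malg K[int]}) (i j : int).

Definition witt_xi i : {malg K[int]} := << i >>.

Definition witt_bracket x y : {malg K[int]} :=
  linext (fun i =>
    linext (fun j => (j%:~R - i%:~R : K) *: witt_xi (i + j)) y) x.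

(* << j >> stands for the density z^(j + beta) (dz/z)^alpha, on which the field
   xi_i = z^(i+1) d/dz acts by Lie derivative; note that xi_i (dz/z) is
   d(z^i) = i z^i (dz/z). *)
Definition density_act alpha beta x v : {malg K[int]} :=
  linext (fun i =>
    linext (fun j => (j%:~R + alpha * i%:~R + beta) *: << i + j >>) v) x.

Lemma witt_bracket_xi i j :
  witt_bracket (witt_xi i) (witt_xi j) =
    (j%:~R - i%:~R : K) *: witt_xi (i + j).
Proof. by rewrite /witt_bracket !linextU. Qed.

Lemma density_act_xi alpha beta i j :
  density_act alpha beta (witt_xi i) << j >> =
    (j%:~R + alpha * i%:~R + beta) *: << i + j >>.
Proof. by rewrite /density_act !linextU. Qed.

Lemma density_act_is_linear alpha beta x : linear (density_act alpha beta x).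
Proof.
move=> a u v; rewrite /density_act -linextZ -linextD.
by apply: eq_linext => i; rewrite linearP.
Qed.

HB.instance Definition _ alpha beta x :=
  GRing.isLinear.Build K {malg K[int]} {malg K[int]} _
    (density_act alpha beta x) (density_act_is_linear alpha beta x).

Lemma density_actP alpha beta a x y v :
  density_act alpha beta (a *: x + y) v =
    a *: density_act alpha beta x v + density_act alpha beta y v.
Proof. exact: linearP. Qed.

Lemma witt_bracketE : witt_bracket =2 density_act (-1) 0.
Proof.
move=> x y; rewrite /witt_bracket /density_act.
apply: eq_linext => i; apply: eq_linext => j.
by rewrite mulN1r addr0.
Qed.

Lemma density_act_bracket alpha beta x y v :
  density_act alpha beta (witt_bracket x y) v =
    density_act alpha beta x (density_act alpha beta y v)
    - density_act alpha beta y (density_act alpha beta x v).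
Proof.
pose A := density_act alpha beta; rewrite -!/(A _ _).
have AP a s t w : A (a *: s + t) w = a *: A s w + A t w
  by exact: density_actP.
have AZ a s w : A (a *: s) w = a *: A s w.
  have A0 : A 0 w = 0 by exact: (linear0 (linext _)).
  by rewrite -[a *: s]addr0 AP A0 addr0.
have lin1 (F : {malg K[int]} -> {malg K[int]}) (H : linear F) :
  {G : {linear {malg K[int]} -> {malg K[int]}} | G =1 F}.
  exists (HB.pack F (GRing.isLinear.Build K _ _ _ F H)
          : {linear {malg K[int]} -> {malg K[int]}}) => //.
have ext (F G : {malg K[int]} -> {malg K[int]}) : linear F -> linear G ->
    (forall i, F << i >> = G << i >>) -> F =1 G.
  move=> /lin1[F' EF] /lin1[G' EG] FG s; rewrite -EF -EG.
  by apply: malg_linear_ext => i; rewrite EF EG.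
have LR s : linear (A s) by exact: density_act_is_linear.
have BL s : linear (witt_bracket s).
  by move=> a t w; rewrite !witt_bracketE linearP.
have BP a s t w :
    witt_bracket (a *: s + t) w = a *: witt_bracket s w + witt_bracket t w.
  by rewrite !witt_bracketE density_actP.
have swap a (p q r s : {malg K[int]}) :
    a *: p + q - (a *: r + s) = a *: (p - r) + (q - s).
  by rewrite opprD addrACA scalerBr.
move: x; apply: (ext (fun x => A (witt_bracket x y) v)
                     (fun x => A x (A y v) - A y (A x v))).
- by move=> a s t; rewrite BP AP.
- by move=> a s t; rewrite !AP LR swap.
move=> i; move: y; apply: (ext (fun y => A (witt_bracket << i >> y) v)
    (fun y => A << i >> (A y v) - A y (A << i >> v))).
- by move=> a s t; rewrite BL AP.
- by move=> a s t; rewrite !AP LR swap.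
move=> j; move: v; apply: (ext (fun v => A (witt_bracket << i >> << j >>) v)
    (fun v => A << i >> (A << j >> v) - A << j >> (A << i >> v))).
- by move=> a s t; rewrite LR.
- by move=> a s t; rewrite !LR swap.
move=> k; rewrite witt_bracket_xi AZ /A !density_act_xi.
rewrite !linearZ /= !density_act_xi !scalerA.
rewrite (addrCA j i k) -(addrA i j k) scalerN scalerA -scalerBl; congr (_ *: _).
by rewrite !intrD; ring.
Qed.

Lemma witt_bracketC x y : witt_bracket x y = - witt_bracket y x.
Proof.
rewrite /witt_bracket /linext -sumrN.
under eq_bigr do rewrite scaler_sumr.
under [RHS]eq_bigr do rewrite scaler_sumr -sumrN.
rewrite exchange_big /=; apply: eq_bigr => j _; apply: eq_bigr => i _.
by rewrite !scalerA -scaleNr (addrC i j) -mulrN opprB (mulrC (mcoeff i x)).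
Qed.

Lemma witt_jacobi x y z :
  witt_bracket x (witt_bracket y z) =
    witt_bracket (witt_bracket x y) z + witt_bracket y (witt_bracket x z).
Proof.
have := density_act_bracket (-1) 0 x y z.
by rewrite -!witt_bracketE => ->; rewrite subrK.
Qed.

Definition in_sl2 x : Prop :=
  exists a b c : K, x = a *: witt_xi (-1) + b *: witt_xi 0 + c *: witt_xi 1.

(* The identification of sl_2 with span {xi_(-1), xi_0, xi_1} for which
   e = E_01, h = E_00 - E_11, f = E_10 become xi_1, 2 xi_0, - xi_(-1). *)
Definition witt_of_sl2 A : {malg K[int]} :=
  A 0 1 *: witt_xi 1 + (2 * A 0 0) *: witt_xi 0 - A 1 0 *: witt_xi (-1).

Lemma mxtrace2_eq0 A : \tr A = 0 -> A 1 1 = - A 0 0.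
Proof.
rewrite /mxtrace !big_ord_recl big_ord0 addr0 => /eqP.
have -> : lift ord0 ord0 = 1 :> 'I_2 by apply: val_inj.
by rewrite addrC addr_eq0 => /eqP.
Qed.

Lemma witt_of_sl2_span x :
  (2 : K) != 0 -> in_sl2 x <-> exists2 A, \tr A = 0 & x = witt_of_sl2 A.
Proof.
move=> nz2; split=> [[a [b [c ->]]]|[A _ ->]]; last first.
  exists (- A 1 0), (2 * A 0 0), (A 0 1).
  by rewrite /witt_of_sl2 scaleNr [RHS]addrC -addrA; congr (_ + _); apply: addrC.
exists (\matrix_(i, j) if i == 0 then if j == 0 then b / 2 else c
                       else if j == 0 then - a else - (b / 2)).
  by rewrite /mxtrace !big_ord_recl big_ord0 !mxE /= addr0 subrr.
rewrite /witt_of_sl2 !mxE /= mulrCA divff // mulr1 scaleNr opprK.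
by rewrite [LHS]addrC -[RHS]addrA; congr (_ + _); apply: addrC.
Qed.

Lemma witt_of_sl2_inj A B :
  (2 : K) != 0 -> \tr A = 0 -> \tr B = 0 ->
  witt_of_sl2 A = witt_of_sl2 B -> A = B.
Proof.
move=> nz2 trA trB /malgP E.
have E00 : A 0 0 = B 0 0.
  have := E 0; rewrite !(mcoeffB, mcoeffD, mcoeffZ, mcoeffU) /=.
  by rewrite !mulr0n !mulr1n !mulr0 !mulr1 !add0r !subr0; apply: mulfI.
have E01 : A 0 1 = B 0 1.
  have := E 1; rewrite !(mcoeffB, mcoeffD, mcoeffZ, mcoeffU) /=.
  by rewrite !mulr0n !mulr1n !mulr0 !mulr1 !addr0 !subr0.
have E10 : A 1 0 = B 1 0.
  have := E (-1); rewrite !(mcoeffB, mcoeffD, mcoeffZ, mcoeffU) /=.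
  by rewrite !mulr0n !mulr1n !mulr0 !mulr1 !addr0 !sub0r; apply: oppr_inj.
have I2 (i : 'I_2) : i = 0 \/ i = 1.
  by case: i => [[|[|//]] ?]; [left | right]; apply: val_inj.
apply/matrixP => i j.
by case: (I2 i) => ->; case: (I2 j) => ->; rewrite ?mxtrace2_eq0 // E00.
Qed.

(* Stated over an abstract module: unification is slow on {malg K[int]}. *)
Fact sl2_bracket_table (V : lmodType K) (br : V -> V -> V) (e h f : V)
    (a b c a' b' c' p q r : K) :
  p = b * a' - a * b' - (b' * a - a' * b) ->
  q = a * c' - a' * c ->
  r = c * b' - b * c' - (c' * b - b' * c) ->
  (forall k (x y z : V), br (k *: x + y) z = k *: br x z + br y z) ->
  (forall x y : V, br x y = - br y x) ->
  br e e = 0 -> br h h = 0 -> br f f = 0 ->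
  br h e = e -> br h f = - f -> br f e = (2 : K) *: h ->
  let w a b c := a *: e + (2 * b) *: h - c *: f in
  w p q r = br (w a b c) (w a' b' c').
Proof.
move=> -> -> -> brl brC ee hh ff he hf fe w.
have br0 (z : V) : br 0 z = 0.
  by move: (brl 1 0 0 z); rewrite !scale1r addr0 => /eqP; rewrite eq_sym
    -subr_eq0 addrK => /eqP.
have brD (x y z : V) : br (x + y) z = br x z + br y z.
  by rewrite -[x]scale1r brl !scale1r.
have brZ k (x z : V) : br (k *: x) z = k *: br x z.
  by rewrite -[k *: x]addr0 brl br0 addr0.
have brDr (x y z : V) : br z (x + y) = br z x + br z y.
  by rewrite ![br z _]brC brD opprD.
have brZr k (x z : V) : br z (k *: x) = k *: br z x.
  by rewrite ![br z _]brC brZ scalerN.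
pose t (x y z : K) : V := x *: e + y *: h + z *: f.
have tD (x y z x' y' z' : K) : t x y z + t x' y' z' = t (x + x') (y + y') (z + z').
  by rewrite /t !scalerDl [LHS]addrACA; congr (_ + _); rewrite addrACA.
have tZ (k x y z : K) : k *: t x y z = t (k * x) (k * y) (k * z).
  by rewrite /t !scalerDr !scalerA.
have wt (x y z : K) : w x y z = t x (2 * y) (- z) by rewrite /w /t scaleNr.
have t0 : 0 = t 0 0 0 by rewrite /t !scale0r !addr0.
have te : br h e = t 1 0 0 by rewrite he /t scale1r !scale0r !addr0.
have tf : br h f = t 0 0 (-1) by rewrite hf /t !scale0r !add0r scaleN1r.
have th : br f e = t 0 2 0 by rewrite fe /t !scale0r addr0 add0r.
have te' : br e h = t (-1) 0 0.
  by rewrite brC te -scaleN1r tZ !mulr0 mulr1.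
have tf' : br f h = t 0 0 1.
  by rewrite brC tf -scaleN1r tZ !mulr0 mulrNN mulr1.
have th' : br e f = t 0 (-2) 0.
  by rewrite brC th -scaleN1r tZ !mulr0 mulN1r.
rewrite !wt {1 2}/t !(brD, brDr) !brZ !brZr ee hh ff te tf th te' tf' th' t0.
by rewrite !tZ !tD; congr t; ring.
Qed.

Lemma witt_of_sl2_bracket A B : \tr A = 0 -> \tr B = 0 ->
  witt_of_sl2 (A *m B - B *m A) =
    witt_bracket (witt_of_sl2 A) (witt_of_sl2 B).
Proof.
move=> trA trB.
have S2 (V : nmodType) (F : 'I_2 -> V) : \sum_i F i = F 0 + F 1.
  by rewrite !big_ord_recl big_ord0 addr0; congr (_ + F _); apply: val_inj.
apply: sl2_bracket_table.
- by rewrite !mxE !S2 (mxtrace2_eq0 trA) (mxtrace2_eq0 trB); ring.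
- by rewrite !mxE !S2; ring.
- by rewrite !mxE !S2 (mxtrace2_eq0 trA) (mxtrace2_eq0 trB); ring.
- by move=> k x y z; rewrite !witt_bracketE density_actP.
- exact: witt_bracketC.
- by rewrite witt_bracket_xi subrr scale0r.
- by rewrite witt_bracket_xi subrr scale0r.
- by rewrite witt_bracket_xi subrr scale0r.
- by rewrite witt_bracket_xi subr0 scale1r.
- by rewrite witt_bracket_xi subr0 scaleN1r.
- by rewrite witt_bracket_xi mulrNz opprK.
Qed.

End Witt.

Section Submodules.
Variable K : fieldType.
Import mpoly monalg.

(* Membership in a [submodClosed] is boolean. This loses no finite dimensional
   subspace of {malg K[int]}, where membership is decided by coordinates. *)
Definition subspace_type (V : lmodType K) (W : submodClosed V) : Type :=
  {v : V | v \in W}.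

HB.instance Definition _ (V : lmodType K) (W : submodClosed V) :=
  SubChoice.on (subspace_type W).
HB.instance Definition _ (V : lmodType K) (W : submodClosed V) :=
  [SubChoice_isSubLmodule of subspace_type W by <:].

Definition has_dim (M : lmodType K) (d : nat) : Prop :=
  inhabited (Vector.axiom d M).

Definition finite_dim (M : lmodType K) : Prop := exists d, has_dim M d.

Definition sl2_stable (alpha beta : K) (W : submodClosed {malg K[int]}) : Prop :=
  forall x v, in_sl2 x -> v \in W -> density_act alpha beta x v \in W.

Definition nonzero_fd_sl2_submodule (alpha beta : K)
    (W : submodClosed {malg K[int]}) : Prop :=
  [/\ sl2_stable alpha beta W, exists2 v, v \in W & v != 0
    & finite_dim (subspace_type W)].

(* W, with sl_2 acting as on V_(alpha, beta), is isomorphic to the space of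
   binary forms of degree n. *)
Definition iso_binary_forms (alpha beta : K)
    (W : submodClosed {malg K[int]}) (n : nat) : Prop :=
  exists2 phi : {linear dhomog 2 K n -> subspace_type W},
    bijective phi &
    forall (A : 'M[K]_2) p, \tr A = 0 ->
      val (phi (form_act_dhomog A p)) =
        density_act alpha beta (witt_of_sl2 A) (val (phi p)).

End Submodules.

Definition is_integer (K : fieldType) (a : K) : Prop :=
  exists m : int, a = m%:~R.

Definition nonpos_half_integer (K : fieldType) (a : K) : Prop :=
  exists2 m : int, (m <= 0)%R & a = m%:~R / 2.

(* Main.v *)
Require Import Defs.
From HB Require Import structures.
From mathcomp Require Import all_boot all_order all_algebra.
From mathcomp Require Import finmap ring zify.
From mathcomp.multinomials Require mpoly.
From mathcomp.multinomials Require Import monalg.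

(* xi_0 acts on V_(alpha, beta) diagonally with the pairwise distinct
   eigenvalues j + beta, so a stable subspace contains every monomial z^j
   occurring in one of its vectors. From z^j, repeated application of xi_1
   (resp. xi_(-1)) yields z^(j+1), z^(j+2), ... (resp. z^(j-1), z^(j-2), ...)
   until the coefficient i + alpha + beta (resp. i - alpha + beta) vanishes.
   A finite dimensional submodule forces this to happen on both sides, hence is
   spanned by z^b, ..., z^(b+n) with b = alpha - beta and
   b + n = - (alpha + beta). Comparing the actions shows that
   X_0^i X_1^(n-i) |-> (-1)^i z^(b+i) intertwines it with binary forms. *)

Set Implicit Arguments.
Unset Strict Implicit.
Unset Printing Implicit Defensive.

Import GRing.Theory.
Local Open Scope ring_scope.

(** * Integers inside a domain of characteristic zero *)

Lemma intr_eq0_pchar0 (R : idomainType) : [pchar R] =i pred0 ->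
  forall m : int, (m%:~R == 0 :> R) = (m == 0).
Proof.
move=> /pcharf0P R0 [n|n]; first by rewrite -pmulrn R0.
by rewrite NegzE mulrNz !oppr_eq0 -pmulrn R0.
Qed.

Lemma intr_inj_pchar0 (R : idomainType) : [pchar R] =i pred0 ->
  injective (fun m : int => m%:~R : R).
Proof.
move=> R0 m n /eqP; rewrite -subr_eq0 -mulrzBr intr_eq0_pchar0 // subr_eq0.
by move/eqP.
Qed.

(** * Spans of consecutive monomials *)

Section Window.
Variable K : fieldType.
Implicit Types (v : {malg K[int]}) (b : int) (n : nat).

Lemma malg_sum_delta v : v = \sum_(j <- msupp v) v@_j *: << j >>.
Proof.
rewrite [LHS]monalgE; apply: eq_bigr => j _.
by apply/malgP => i; rewrite mcoeffZ !mcoeffU mulrnAr mulr1.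
Qed.

Lemma mcoeff_sum_delta (I : finType) (c : I -> K) (f : I -> int) k :
  injective f -> (\sum_i c i *: << f i >>)@_(f k) = c k.
Proof.
move=> f_inj; rewrite raddf_sum (bigD1 k) //= mcoeffZ mcoeffUU mulr1.
rewrite big1 ?addr0 // => i ik.
by rewrite mcoeffZ mcoeffU (inj_eq f_inj) (negPf ik) mulr0.
Qed.

(** The span of [z^b, ..., z^(b+n)], encoded as a bound on the support: membership is then boolean,
    as a [submodClosed] requires. *)
Definition window b n : {pred {malg K[int]}} :=
  [pred v | all (fun j => b <= j <= b + n%:Z) (msupp v)].

Lemma windowP b n v :
  reflect (forall j, v@_j != 0 -> b <= j <= b + n%:Z) (v \in window b n).
Proof.
apply: (iffP allP) => H j; first by rewrite mcoeff_neq0; apply: H.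
by move=> jv; apply: H; rewrite mcoeff_neq0.
Qed.

Lemma window_submod_closed b n : submod_closed (window b n).
Proof.
split=> [|a u v /windowP uW /windowP vW]; apply/windowP => j.
  by rewrite mcoeff0 eqxx.
rewrite mcoeffD mcoeffZ; have [uj|/uW//] := eqVneq u@_j 0.
by rewrite uj mulr0 add0r => /vW.
Qed.

HB.instance Definition _ b n :=
  GRing.isSubmodClosed.Build K {malg K[int]} (window b n)
    (window_submod_closed b n).

Lemma window_delta b n j : b <= j <= b + n%:Z -> << j >> \in window b n.
Proof.
by move=> jW; apply/windowP => i; rewrite mcoeffU; case: (eqVneq j i) => [<-|]; rewrite ?eqxx.
Qed.

Lemma window_deltaD b n i : (i <= n)%N -> << b + i%:Z >> \in window b n.
Proof. by move=> ?; apply: window_delta; lia. Qed.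

Lemma window_mcoeff_eq b n u v : u \in window b n -> v \in window b n ->
  (forall i, (i <= n)%N -> u@_(b + i%:Z) = v@_(b + i%:Z)) -> u = v.
Proof.
move=> /windowP uW /windowP vW uv; apply/malgP => j.
have [jW|] := boolP (b <= j <= b + n%:Z).
  have -> : j = b + `|j - b|%N%:Z by lia.
  by apply: uv; lia.
by move=> jW; rewrite (contraNeq (uW j) jW) (contraNeq (vW j) jW).
Qed.

Lemma window_dim b n : has_dim (subspace_type (window b n)) n.+1.
Proof.
pose f (u : subspace_type (window b n)) : 'rV[K]_n.+1 :=
  \row_(i < n.+1) (val u)@_(b + i%:Z).
have f_lin : linear f.
  move=> a u v; apply/rowP => i.
  by rewrite !mxE GRing.valD GRing.valZ mcoeffD mcoeffZ.
pose g0 (r : 'rV[K]_n.+1) : {malg K[int]} := \sum_(i < n.+1) r 0 i *: << b + i%:Z >>.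
have gW r : g0 r \in window b n.
  by apply: rpred_sum => i _; apply: rpredZ; apply: window_deltaD; rewrite -ltnS.
have g0E r (i : 'I_n.+1) : (g0 r)@_(b + i%:Z) = r 0 i.
  apply: (@mcoeff_sum_delta _ _ (fun j : 'I_n.+1 => b + (j : nat)%:Z)).
  by move=> j k /addrI[?]; apply: val_inj.
constructor; exists f => //; exists (fun r => Sub (g0 r) (gW r)).
  move=> u; apply: val_inj; apply: (@window_mcoeff_eq b n); [exact: gW|exact: valP|].
  move=> i; rewrite -ltnS => ilt; rewrite SubK.
  by rewrite -[i]/(nat_of_ord (Ordinal ilt)) g0E mxE.
by move=> r; apply/rowP => i; rewrite mxE SubK g0E.
Qed.

End Window.

(** * Subspaces stable under [sl_2] *)

Section Stable.
Variables (K : fieldType) (alpha beta : K).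
Implicit Types (v : {malg K[int]}) (W : submodClosed {malg K[int]}).

Lemma in_sl2_xi i : -1 <= i <= 1 -> in_sl2 (witt_xi K i).
Proof.
move=> iB; have [->|[->|->]] : i = -1 \/ i = 0 \/ i = 1 by lia.
- by exists 1, 0, 0; rewrite scale1r !scale0r !addr0.
- by exists 0, 1, 0; rewrite scale1r !scale0r addr0 add0r.
- by exists 0, 0, 1; rewrite scale1r !scale0r !add0r.
Qed.

Lemma sl2_stable_gen W :
  (forall i v, -1 <= i <= 1 -> v \in W ->
     density_act alpha beta (witt_xi K i) v \in W) ->
  sl2_stable alpha beta W.
Proof.
move=> WS x v [a [b [c ->]]] vW; rewrite -[c *: _]addr0 -addrA !density_actP.
rewrite rpredD ?rpredZ ?WS // rpredD ?rpredZ ?WS // rpredD ?rpredZ ?WS //.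
rewrite (_ : density_act _ _ 0 _ = 0) ?rpred0 //; exact: (linear0 (linext _)).
Qed.

Lemma mcoeff_density_xi0 v j :
  (density_act alpha beta (witt_xi K 0) v)@_j = (j%:~R + beta) * v@_j.
Proof.
rewrite {1}(malg_sum_delta v) linear_sum raddf_sum /=.
rewrite [v in RHS]malg_sum_delta raddf_sum mulr_sumr /=; apply: eq_bigr => i _.
rewrite linearZ /= density_act_xi !mcoeffZ !mcoeffU add0r mulr0z mulr0 addr0.
by case: eqVneq => [->|_]; rewrite ?mulr0 ?mulr1 // mulrC.
Qed.

Section Submodule.
Variable W : submodClosed {malg K[int]}.
Hypothesis Wst : sl2_stable alpha beta W.

Lemma stable_step e j : -1 <= e <= 1 -> j%:~R + alpha * e%:~R + beta != 0 ->
  << j >> \in W -> << j + e >> \in W.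
Proof.
move=> eB nz jW; have := Wst (in_sl2_xi eB) jW.
rewrite density_act_xi (addrC e) => /(rpredZ (j%:~R + alpha * e%:~R + beta)^-1).
by rewrite scalerA mulVf // scale1r.
Qed.

(** The last exponent [j + e * n] is reached but not left, so the coefficient there is free to
    vanish. *)
Lemma stable_steps e j n : -1 <= e <= 1 ->
    (forall i, (i < n)%N -> (j + e * i%:Z)%:~R + alpha * e%:~R + beta != 0) ->
  << j >> \in W -> << j + e * n%:Z >> \in W.
Proof.
move=> eB; elim: n => [|n IH] nz jW; first by rewrite mulr0 addr0.
rewrite -addn1 PoszD mulrDr mulr1 addrA; apply: stable_step => //; first exact: nz.
by apply: IH => // i ilt; apply: nz; rewrite ltnW.
Qed.

Hypothesis charK : [pchar K] =i pred0.

(** The operator [xi_0 - (k + beta)] multiplies the coefficient at each [i] by [i - k]: it removes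
    [z^k] and, in characteristic zero, keeps the coefficient at [j] nonzero if [j != k]. Removing
    every other exponent of [v] leaves a nonzero multiple of [z^j]. *)
Lemma stable_support v j : v \in W -> v@_j != 0 -> << j >> \in W.
Proof.
move=> vW vj.
have ker (s : seq int) : j \notin s -> exists u,
    [/\ u \in W, u@_j != 0 & forall i, v@_i = 0 \/ i \in s -> u@_i = 0].
  elim: s => [|k s IH]; first by move=> _; exists v; split=> // i [].
  rewrite inE negb_or => /andP[jk /IH[u [uW uj us]]].
  exists (density_act alpha beta (witt_xi K 0) u - (k%:~R + beta) *: u).
  have cE i : (density_act alpha beta (witt_xi K 0) u - (k%:~R + beta) *: u)@_i
      = (i - k)%:~R * u@_i.
    by rewrite mcoeffB mcoeffZ mcoeff_density_xi0 intrB; ring.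
  split=> [||i].
  - by rewrite -scaleNr rpredD ?rpredZ // Wst //; apply: in_sl2_xi.
  - by rewrite cE mulf_neq0 // intr_eq0_pchar0 // subr_eq0.
  - rewrite cE inE => -[vi|/orP[/eqP->|si]]; last 2 [by rewrite subrr mul0r]
      || by rewrite us ?mulr0 //; tauto.
have [|u [uW uj us]] := ker [seq i <- msupp v | i != j].
  by rewrite mem_filter eqxx.
suff -> : << j >> = (u@_j)^-1 *: u by rewrite rpredZ.
apply/malgP => i; rewrite mcoeffZ mcoeffU; case: eqP => [<-|/eqP ji].
  by rewrite mulVf.
rewrite (us i) ?mulr0 // mem_filter eq_sym ji /=.
by case: (msuppP v i) => ?; [right | left].
Qed.

Hypothesis Wfd : finite_dim (subspace_type W).

(** Otherwise the first [d + 1] monomials on the path from [z^j] in direction [e], distinct since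
    [e != 0], would all lie in a space of dimension [d]. *)
Lemma finite_dim_stop e j : -1 <= e <= 1 -> e != 0 -> << j >> \in W ->
  exists n : nat, (j + e * n%:Z)%:~R + alpha * e%:~R + beta = 0.
Proof.
move=> eB e0 jW; have [d [[f f_lin f_bij]]] := Wfd.
pose P (i : 'I_d.+1) := (j + e * (i : nat)%:Z)%:~R + alpha * e%:~R + beta == 0.
have [i /eqP Pi|noP] := pickP P; first by exists i.
exfalso; have zW (i : 'I_d.+1) : << j + e * (i : nat)%:Z >> \in W.
  apply: stable_steps => // k ki; have kd : (k < d.+1)%N by apply: ltn_trans ki _.
  by have := negbT (noP (Ordinal kd)).
pose z i : subspace_type W := exist (fun v => v \in W) _ (zW i).
pose fL := HB.pack_for {linear subspace_type W -> 'rV[K]_d} f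
  (GRing.isLinear.Build _ _ _ _ f f_lin).
pose M := \matrix_i fL (z i).
(* [M] has [d + 1] rows and [d] columns, so its rows satisfy a nontrivial relation [u]; injectivity
   of [f] carries it back to the monomials. *)
have /rowV0Pn[u /sub_kermxP uM u0] : kermx M != 0.
  by rewrite kermx_eq0 /row_free neq_ltn ltnS rank_leq_col.
have : fL (\sum_i u 0 i *: z i) = fL 0.
  rewrite linear0 -[RHS]uM linear_sum mulmx_sum_row; apply: eq_bigr => i _.
  by rewrite linearZ rowK.
move/(bij_inj f_bij)/(congr1 val); rewrite raddf_sum /= => uz.
case/negP: u0; apply/eqP/rowP => i; rewrite mxE.
have := congr1 (mcoeff (j + e * (i : nat)%:Z)) uz.
rewrite mcoeff0 => <-; apply/esym.
apply: (@mcoeff_sum_delta _ _ _ (fun k : 'I_d.+1 => j + e * (k : nat)%:Z)).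
by move=> k l /addrI/(mulfI e0)[?]; apply: val_inj.
Qed.

Lemma stable_ends j : << j >> \in W -> exists b n,
  [/\ b%:~R = alpha - beta, (b + n%:Z)%:~R = - (alpha + beta)
    & b <= j <= b + n%:Z].
Proof.
move=> jW; have [m] := @finite_dim_stop 1 j isT isT jW.
have [k] := @finite_dim_stop (-1) j isT isT jW.
rewrite mulN1r mulrN1 mulr1 mul1r => Ek Em.
(* [k] and [m] count the steps from [z^j] until [xi_(-1)], respectively [xi_1], acts by zero. *)
exists (j - k%:Z), (k + m)%N; split.
- by apply/eqP; rewrite -subr_eq0 -Ek; apply/eqP; ring.
- rewrite PoszD addrA subrK; apply/eqP; rewrite -subr_eq0 -Em; apply/eqP; ring.
- lia.
Qed.

(** The two stopping exponents depend only on [alpha] and [beta], since integers embed in [K]; this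
    confines [W] to the window. Conversely, strictly before these exponents no coefficient vanishes,
    so a single monomial of [W] generates all the others. *)
Lemma stable_eq_window b n : b%:~R = alpha - beta ->
    (b + n%:Z)%:~R = - (alpha + beta) ->
  (exists2 v, v \in W & v != 0) -> W =i window b n.
Proof.
move=> bE tE [w wW w0].
have bounds j : << j >> \in W -> b <= j <= b + n%:Z.
  move=> /stable_ends[b' [n' [b'E t'E]]].
  have {b'E} bb : b' = b by apply: (intr_inj_pchar0 charK); rewrite /= bE b'E.
  suff <- : b + n'%:Z = b + n%:Z by rewrite -bb.
  by apply: (intr_inj_pchar0 charK); rewrite /= tE -t'E bb.
have [j jW] : exists j, << j >> \in W.
  have [s0|[j jw]] := fset_0Vmem (msupp w).
    by move: w0; rewrite (malg_sum_delta w) s0 big_seq_fset0 eqxx.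
  by exists j; apply: (@stable_support w); rewrite ?mcoeff_neq0.
have jB := bounds j jW.
have all_in (i : int) : b <= i <= b + n%:Z -> << i >> \in W.
  move=> iB; have [ij|ji] := boolP (i <= j).
    have -> : i = j + (-1) * `|j - i|%N%:Z by lia.
    apply: stable_steps => // k kB.
    (* Going down, the coefficient at an exponent is its distance to [b], which is positive at every
       exponent that is left; going up, the same holds with [b + n] and the opposite sign. *)
    have -> : (j + -1 * k%:Z)%:~R + alpha * (-1)%:~R + beta
        = (j + -1 * k%:Z - b)%:~R :> K by rewrite intrB bE; ring.
    by rewrite intr_eq0_pchar0 //; lia.
  have -> : i = j + 1 * `|i - j|%N%:Z by lia.
  apply: stable_steps => // k kB.
  have -> : (j + 1 * k%:Z)%:~R + alpha * 1%:~R + beta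
      = (j + 1 * k%:Z - (b + n%:Z))%:~R :> K by rewrite intrB tE; ring.
  by rewrite intr_eq0_pchar0 //; lia.
move=> v; apply/idP/windowP => [vW i vi|vB].
  by apply: bounds; apply: stable_support vi.
rewrite (malg_sum_delta v) big_seq; apply: rpred_sum => i iv.
by rewrite rpredZ // all_in // vB // mcoeff_neq0.
Qed.

End Submodule.

Lemma window_stable b n : b%:~R = alpha - beta ->
  (b + n%:Z)%:~R = - (alpha + beta) -> sl2_stable alpha beta (window b n).
Proof.
move=> bE tE; apply: sl2_stable_gen => i v iB /windowP vW.
rewrite (malg_sum_delta v) linear_sum big_seq; apply: rpred_sum => j jv.
have {}jv : b <= j <= b + n%:Z by apply: vW; rewrite mcoeff_neq0.
rewrite linearZ rpredZ //= density_act_xi.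
have [c0|c0] := eqVneq (j%:~R + alpha * i%:~R + beta) 0.
  by rewrite c0 scale0r rpred0.
apply: rpredZ; apply: window_delta; apply: contraNT c0 => ijW.
(* The window can only be left by [xi_1] at the top or by [xi_(-1)] at the bottom, and there the
   coefficient is zero. *)
have [[-> ->]|[-> ->]] : (i = 1 /\ j = b + n%:Z) \/ (i = -1 /\ j = b) by lia.
  by rewrite tE; apply/eqP; ring.
by rewrite bE; apply/eqP; ring.
Qed.

End Stable.

(* Over an abstract module because unification is slow on {malg K[int]}. *)
Lemma sl2_act_table (K : fieldType) (V : lmodType K) (u up dn : V)
    (a00 a01 a10 c00 c01 c10 c11 d0 d1 d2 : K) :
  c00 - c11 = 2 * d0 -> c01 = d1 -> c10 = - d2 ->
  a00 *: (c00 *: u) + a01 *: (c01 *: up)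
    + (a10 *: (c10 *: dn) + (- a00) *: (c11 *: u)) =
  a01 *: (d1 *: up) + (2 * a00) *: (d0 *: u) - a10 *: (d2 *: dn).
Proof.
move=> c0 -> ->; rewrite !scalerA mulrN scaleNr.
have -> : 2 * a00 * d0 = a00 * c00 + - a00 * c11 by rewrite mulrAC -c0; ring.
by rewrite scalerDl [LHS](AC (2*2) (2*(1*4)*3)).
Qed.

(** * The isomorphism with binary forms *)

Section Intertwiner.
Import mpoly.
Variables (K : fieldType) (alpha beta : K) (b : int) (n : nat).
(* In type_scope the notation of monalg would otherwise take precedence. *)
Local Notation "{ 'mpoly' R [ n ] }" := (mpoly n R) : type_scope.
Local Notation z i := (<< i >> : {malg K[int]}).
Implicit Types (p q : {mpoly K[2]}) (m : 'X_{1..2}) (A : 'M[K]_2).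

(** The exponent of [X_0^i X_1^(n-i)]. The subtraction truncates, so the degree is [n] only for
    [i <= n]. *)
Definition bimonom i : 'X_{1..2} := (U_(ord0) *+ i + U_(lift ord0 ord0) *+ (n - i))%MM.

(* Sends 'X_0 ^+ i * 'X_1 ^+ (n - i) to (-1) ^+ i *: z^(b + i). *)
Definition form_density p : {malg K[int]} :=
  \sum_(i < n.+1) ((-1) ^+ i * p@_(bimonom i)) *: << b + (i : nat)%:Z >>.

Lemma form_density_is_linear : linear form_density.
Proof.
move=> a p q; rewrite /form_density scaler_sumr -big_split /=.
apply: eq_bigr => i _.
by rewrite mcoeffD mcoeffZ mulrDr scalerDl scalerA mulrCA.
Qed.

HB.instance Definition _ := GRing.isLinear.Build K {mpoly K[2]} {malg K[int]} _
  form_density form_density_is_linear.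

Lemma form_density_window p : form_density p \in window b n.
Proof.
by apply: rpred_sum => i _; apply: rpredZ; apply: window_deltaD; rewrite -ltnS.
Qed.

Lemma mdeg2 m : mdeg m = (m ord0 + m (lift ord0 ord0))%N.
Proof. by rewrite mdegE !big_ord_recl big_ord0 addn0. Qed.

Lemma bimonom0 i : bimonom i ord0 = i.
Proof. by rewrite mnmDE !mulmnE !mnm1E /= mul1n mul0n addn0. Qed.

Lemma bimonom1 i : bimonom i (lift ord0 ord0) = (n - i)%N.
Proof. by rewrite mnmDE !mulmnE !mnm1E /= mul0n mul1n. Qed.

Lemma mdeg_bimonom i : (i <= n)%N -> mdeg (bimonom i) = n.
Proof. by move=> ?; rewrite mdeg2 bimonom0 bimonom1 subnKC. Qed.

Lemma bimonomE m : mdeg m = n -> m = bimonom (m ord0).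
Proof.
rewrite mdeg2 => mn; apply/mnmP => i.
by case: (unliftP ord0 i) => [j|] ->; rewrite ?bimonom0 // ord1 bimonom1 -mn addKn.
Qed.

Lemma form_densityX m : mdeg m = n ->
  form_density 'X_[m] = (-1) ^+ (m ord0) *: z (b + (m ord0)%:Z).
Proof.
move=> mn; have m0 : (m ord0 < n.+1)%N by rewrite ltnS -mn mdeg2 leq_addr.
rewrite /form_density (bigD1 (Ordinal m0)) //= big1 ?addr0 => [|i im].
  by rewrite mcoeffX -bimonomE // eqxx mulr1.
rewrite mcoeffX (_ : (m == _) = false) ?mulr0 ?scale0r //.
by apply: contra_neqF im => /eqP E; apply: val_inj; rewrite /= E bimonom0.
Qed.

Lemma form_act_is_linear A : linear (form_act A).
Proof.
move=> a p q; rewrite /form_act scaler_sumr -big_split; apply: eq_bigr => i _ /=.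
rewrite scaler_sumr -big_split; apply: eq_bigr => j _ /=.
by rewrite mderivD mderivZ mulrDr scalerDr -scalerAr !scalerA [a * _]mulrC.
Qed.

HB.instance Definition _ A := GRing.isLinear.Build K {mpoly K[2]} {mpoly K[2]} _
  (form_act A) (form_act_is_linear A).

Lemma form_actX A m : form_act A 'X_[m] =
  \sum_(i < 2) \sum_(j < 2) (A i j * (m j)%:R) *: 'X_[U_(i) + (m - U_(j))].
Proof.
apply: eq_bigr => i _; apply: eq_bigr => j _.
by rewrite mderivX -scalerAr scalerA mpolyXD.
Qed.

(** The factor [(m j)%:R] covers the case [m j = 0], where [m - U_(j)] truncates to [m] and the
    monomial has the wrong degree [n + 1]. In the sign, [(j == ord0)] is added rather than
    subtracted, which leaves the parity unchanged. *)
Lemma form_density_shift i j m : mdeg m = n ->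
  (m j)%:R *: form_density 'X_[U_(i) + (m - U_(j))] =
  ((m j)%:R * (-1) ^+ (m ord0 + (i == ord0) + (j == ord0))) *:
     z (b + (m ord0)%:Z + (i == ord0)%:Z - (j == ord0)%:Z).
Proof.
move=> mn; have [mj0|mj] := posnP (m j); first by rewrite mj0 mul0r !scale0r.
have jm : (U_(j) <= m)%MM by rewrite lep1mP -lt0n.
have deg : (1 + mdeg (m - U_(j)))%N = n.
  by rewrite -[RHS]mn -[in RHS](submK jm) mdegD mdeg1 addnC.
have m0 : (m ord0 = (m - U_(j))%MM ord0 + (j == ord0))%N.
  by rewrite -[in LHS](submK jm) mnmDE mnm1E.
rewrite form_densityX ?mdegD ?mdeg1 // scalerA mnmDE mnm1E m0.
set k := (m - U_(j))%MM ord0; congr (_ * _ *: << _ >>).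
  by rewrite -signr_odd -[RHS]signr_odd !oddD; do 3![case: odd].
by lia.
Qed.

Lemma density_act_sl2 A (v : {malg K[int]}) :
  density_act alpha beta (witt_of_sl2 A) v =
    A 0 1 *: density_act alpha beta (witt_xi K 1) v
    + (2 * A 0 0) *: density_act alpha beta (witt_xi K 0) v
    - A 1 0 *: density_act alpha beta (witt_xi K (-1)) v.
Proof. by rewrite /witt_of_sl2 /density_act linearB linearD !linearZ. Qed.

Lemma density_act_xiZ i j c :
  density_act alpha beta (witt_xi K i) (c *: z j) =
    (c * (j%:~R + alpha * i%:~R + beta)) *: z (i + j).
Proof.
rewrite (_ : density_act _ _ _ _ = c *: density_act alpha beta (witt_xi K i) (z j)).
  by rewrite density_act_xi scalerA.
exact: linearZ.
Qed.

Hypotheses (bE : b%:~R = alpha - beta) (tE : (b + n%:Z)%:~R = - (alpha + beta)).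

(** By linearity [p] may be taken to be a monomial. Both sides then combine the same [z^(k-1)],
    [z^k] and [z^(k+1)], and the coefficients agree because [n = -2 alpha]. *)
Lemma form_densityP A p : \tr A = 0 -> p \is n.-homog ->
  form_density (form_act A p) =
    density_act alpha beta (witt_of_sl2 A) (form_density p).
Proof.
move=> trA /dhomogP p_homog; rewrite (mpolyE p).
rewrite (linear_sum (form_act A)) !(linear_sum form_density).
rewrite (linear_sum (density_act alpha beta (witt_of_sl2 A))) !big_seq /=.
apply: eq_bigr => m /p_homog /= mn; rewrite !linearZ /=; congr (_ *: _).
have i1 : lift ord0 ord0 = 1 :> 'I_2 by apply: val_inj.
have shift i j : form_density ((A i j * (m j)%:R) *: 'X_[U_(i) + (m - U_(j))])
    = A i j *: (((m j)%:R * (-1) ^+ (m ord0 + (i == ord0) + (j == ord0))) *: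
        z (b + (m ord0)%:Z + (i == ord0)%:Z - (j == ord0)%:Z)).
  rewrite (_ : form_density _ = (A i j * (m j)%:R) *:
      form_density 'X_[U_(i) + (m - U_(j))]); last exact: linearZ.
  by rewrite -scalerA form_density_shift.
have form_density2 (F : 'I_2 -> {mpoly K[2]}) :
    form_density (\sum_i F i) = form_density (F ord0) + form_density (F 1).
  by rewrite linear_sum big_ord_recl big_ord1 i1.
rewrite form_actX !form_density2 !shift /= form_densityX //.
rewrite density_act_sl2 !density_act_xiZ.
have -> : A 1 1 = - A ord0 ord0 by exact: mxtrace2_eq0.
set N := m ord0; have [k kE] : exists k, k = b + N%:Z by exists (b + N%:Z).
rewrite -!kE.
rewrite (_ : k + 1%:Z - 1%:Z = k); last by rewrite addrK.
rewrite (_ : k + 1%:Z - 0%:Z = k + 1); last by rewrite subr0.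
rewrite (_ : k + 0%:Z - 1%:Z = k - 1); last by rewrite addr0.
rewrite (_ : k + 0%:Z - 0%:Z = k); last by rewrite addr0 subr0.
rewrite (addrC 1 k) (addrC (-1) k) add0r !addn0.
(* This is the difference of [tE] and [bE]. *)
have nK : n%:R = - (2 * alpha) :> K.
  by apply: (addrI b%:~R); rewrite -[LHS](intrD _ b n%:Z) tE bE; ring.
have m1K : (m 1)%:R = - (2 * alpha) - N%:R :> K.
  by rewrite -nK -mn mdeg2 i1 natrD addrC addKr.
have kK : k%:~R = alpha - beta + N%:R :> K by rewrite kE intrD bE.
by apply: sl2_act_table; rewrite !addn1 !exprS ?m1K kK; ring.
Qed.

Lemma form_density_mcoeff p i : (i <= n)%N ->
  monalg.mcoeff (b + i%:Z) (form_density p) = (-1) ^+ i * p@_(bimonom i).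
Proof.
rewrite -ltnS => ilt.
apply: (@mcoeff_sum_delta _ _ _ (fun j : 'I_n.+1 => b + (j : nat)%:Z) (Ordinal ilt)).
by move=> j k /addrI[?]; apply: val_inj.
Qed.

(** The inverse of [form_density] between forms of degree [n] and the window; the same sign occurs
    because [(-1)^i] is its own inverse. *)
Definition density_form (v : {malg K[int]}) : {mpoly K[2]} :=
  \sum_(i < n.+1) ((-1) ^+ i * monalg.mcoeff (b + (i : nat)%:Z) v) *: 'X_[bimonom i].

Lemma density_form_homog v : density_form v \is n.-homog.
Proof.
apply: rpred_sum => i _; apply: rpredZ.
by rewrite dhomogX /= mdeg_bimonom // -ltnS.
Qed.

Lemma density_form_mcoeff v i : (i <= n)%N ->
  (density_form v)@_(bimonom i) = (-1) ^+ i * monalg.mcoeff (b + i%:Z) v.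
Proof.
rewrite -ltnS => ilt.
rewrite raddf_sum (bigD1 (Ordinal ilt)) //= mcoeffZ mcoeffX eqxx mulr1.
rewrite big1 ?addr0 // => j ji.
rewrite mcoeffZ mcoeffX (_ : (_ == _) = false) ?mulr0 //.
apply: contra_neqF ji => /eqP E; apply: val_inj.
by have := congr1 (fun m : 'X_{1..2} => m ord0) E; rewrite !bimonom0.
Qed.

Lemma window_iso_binary_forms : iso_binary_forms alpha beta (window b n) n.
Proof.
pose W : submodClosed {malg K[int]} := window b n.
pose phi (p : dhomog 2 K n) : subspace_type W :=
  exist (fun v => v \in W) _ (form_density_window p).
have phi_lin : linear phi by move=> a p q; apply: val_inj; exact: linearP.
pose phiL := HB.pack_for {linear dhomog 2 K n -> subspace_type W} phi
  (GRing.isLinear.Build _ _ _ _ phi phi_lin).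
exists phiL; last first.
  by move=> A p trA; apply: form_densityP => //; apply: dhomog_is_dhomog.
pose psi (w : subspace_type W) : dhomog 2 K n := DHomog (density_form_homog (sval w)).
exists psi => [p|w]; apply: val_inj.
  apply/mpolyP => m /=; have [mn|mn] := eqVneq (mdeg m) n; last first.
    rewrite (dhomog_nemf_coeff (density_form_homog _) mn).
    by rewrite (dhomog_nemf_coeff (dhomog_is_dhomog p) mn).
  have m0 : (m ord0 <= n)%N by rewrite -mn mdeg2 leq_addr.
  rewrite [m in LHS](bimonomE mn) density_form_mcoeff // form_density_mcoeff //.
  by rewrite mulrA -expr2 sqrr_sign mul1r -bimonomE.
apply: (@window_mcoeff_eq _ b n); [exact: form_density_window|exact: valP|].
move=> i ilt; rewrite form_density_mcoeff // density_form_mcoeff //.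
by rewrite mulrA -expr2 sqrr_sign mul1r.
Qed.

End Intertwiner.

(** * Classification of the finite dimensional submodules *)

Theorem theorem5p5 (K : fieldType) (charK : [pchar K] =i pred0)
    (alpha beta : K) :
  ((exists W : submodClosed {malg K[int]},
      nonzero_fd_sl2_submodule alpha beta W)
   <-> (nonpos_half_integer alpha /\ is_integer (alpha + beta)))
  /\
  (nonpos_half_integer alpha -> is_integer (alpha + beta) ->
   exists W : submodClosed {malg K[int]},
     [/\ nonzero_fd_sl2_submodule alpha beta W,
         (forall W' : submodClosed {malg K[int]},
            nonzero_fd_sl2_submodule alpha beta W' -> W' =i W)
       & exists n : nat,
           [/\ n%:R = - (2 * alpha), has_dim (subspace_type W) n.+1
             & iso_binary_forms alpha beta W n]]).
Proof.
have nz2 : (2 : K) != 0 by have /pcharf0P -> := charK.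
have ends : nonpos_half_integer alpha -> is_integer (alpha + beta) ->
    exists b n, b%:~R = alpha - beta /\ (b + n%:Z)%:~R = - (alpha + beta).
  (* With [alpha = m / 2] and [alpha + beta = t], the lower end
     [alpha - beta = 2 alpha - (alpha + beta)] is [m - t], and the length [-2 alpha] is [-m]. *)
  move=> [m m0 aE] [t tE]; exists (m - t), `|m|%N.
  have m_abs : `|m|%N%:Z = - m by lia.
  have -> : alpha - beta = 2 * alpha - (alpha + beta) by ring.
  have mE : m%:~R = 2 * alpha by rewrite aE mulrC divfK.
  by rewrite m_abs !intrD !intrN tE mE; split=> //; ring.
have main b n : b%:~R = alpha - beta -> (b + n%:Z)%:~R = - (alpha + beta) ->
    nonzero_fd_sl2_submodule alpha beta (window b n : submodClosed {malg K[int]}).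
  move=> bE tE; split; first exact: window_stable.
    exists << b >>; first by apply: window_delta; lia.
    by rewrite monalgU_eq0 oner_eq0.
  by exists n.+1; apply: window_dim.
split.
  split=> [[W [Wst [v vW v0] Wfd]]|[aH tH]]; last first.
    have [b [n [bE tE]]] := ends aH tH.
    by exists (window b n : submodClosed {malg K[int]}); apply: main.
  have [s0|[j jv]] := fset_0Vmem (msupp v).
    by move: v0; rewrite (malg_sum_delta v) s0 big_seq_fset0 eqxx.
  have jW : << j >> \in W by apply: (stable_support Wst charK vW); rewrite mcoeff_neq0.
  have [b [n [bE tE _]]] := stable_ends Wst Wfd jW.
  split; last by exists (- (b + n%:Z)); rewrite intrN tE opprK.
  (* Subtracting the upper end from the lower one gives [-n = 2 alpha]. *)
  exists (- n%:Z); first by lia.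
  have -> : - n%:Z = b - (b + n%:Z) by lia.
  by rewrite intrB bE tE opprK; apply: (mulIf nz2); rewrite divfK //; ring.
move=> aH tH; have [b [n [bE tE]]] := ends aH tH.
exists (window b n : submodClosed {malg K[int]}); split; first exact: main.
  by move=> W' [Wst Wnz Wfd]; apply: (stable_eq_window Wst charK Wfd).
exists n; split; [|exact: window_dim|exact: window_iso_binary_forms].
by apply: (addrI b%:~R); rewrite -[LHS](intrD _ b n%:Z) tE bE; ring.
Qed.
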